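(* Let $n>1$ be an integer. Consider the following algorithm with input $n$. 1. Set $C:=\{[n]\}$. 2. For each integer $i$ with $2\le i\le n-2$, set $T(i):=\{[i]\}$ if $i\le\lfloor n/2\rfloor$, and $T(i):=\emptyset$ otherwise. 3. For $i=2,3,\ldots,n-2$, in this order, and for each $M\in T(i)$: (a) if $n-i\in \mathrm{AS}(M)$, replace $C$ by $C\cup\{[n-i,M]\}$; (b) for each $k\in \mathrm{AS}(M)\cap\{2,\ldots,\lfloor (n-i)/2\rfloor\}$, replace $T(i+k)$ by $T(i+k)\cup\{[k,M]\}$. 4. Return $C$. Then the set $C$ returned by the algorithm is equal to $\mathrm{Cond}(n)$, the set of all multiplicity sequences of Arf numerical semigroups with conductor $n$.
   Context: $\mathbb N$ contains $0$ and $\mathbb N^*=\mathbb N\setminus\{0\}$. A numerical semigroup is a submonoid $S$ of $(\mathbb N,+)$ with $\mathbb N\setminus S$ finite; its conductor is the smallest $c\in\mathbb N$ such that $n\in S$ for all $n\ge c$. $S$ is Arf if for each $s\in S$ the set $S(s)-s$ is a semigroup, where $S(s)=\{n\in S: n\ge s\}$. A multiplicity sequence is a nonincreasing sequence $M=\{m_n\}_{n\ge1}$ of elements of $\mathbb N^*$ such that (i) there is $k\in\mathbb N^*$ with $m_n=1$ for all $n\ge k$; (ii) for every $n\in\mathbb N^*$ there is $s(n)\ge n+1$ with $m_n=\sum_{k=n+1}^{s(n)}m_k$. A multiplicity sequence different from the constant sequence $1$ is written as the finite vector $M=[m_1,\ldots,m_k]$ where $m_k$ is the last entry different from $1$; the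 constant sequence $1$ is written $[1]$. Multiplicity sequences are in one-to-one correspondence with Arf numerical semigroups: to $M=[m_1,\ldots,m_k]$ corresponds $\mathrm{AS}(M)=\{0,m_1,m_1+m_2,\ldots,m_1+\cdots+m_k,\rightarrow\}$, where $n\rightarrow$ means that all integers larger than $n$ belong to the set (and $\mathrm{AS}([1])=\mathbb N$). The conductor of $\mathrm{AS}(M)$ is $m_1+\cdots+m_k$ if $M\neq[1]$, and is $0$ if $M=[1]$. $\mathrm{Cond}(n)$ denotes the set of multiplicity sequences $M$ such that $\mathrm{AS}(M)$ has conductor $n$. For $M=[m_1,\ldots,m_k]$ and an integer $a$, $[a,M]$ denotes the vector $[a,m_1,\ldots,m_k]$. *)

(* Defs.v *)
From mathcomp Require Import all_boot finmap.

Set Implicit Arguments.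
Unset Strict Implicit.
Unset Printing Implicit Defensive.

Local Open Scope fset_scope.
Local Open Scope nat_scope.

(** * Numerical semigroups *)

Definition add_closed (S : {pred nat}) : Prop :=
  forall x y, x \in S -> y \in S -> x + y \in S.

Definition numerical_semigroup (S : {pred nat}) : Prop :=
  [/\ 0 \in S, add_closed S &
      exists gaps : seq nat, forall x, x \notin S -> x \in gaps].

Definition is_conductor (S : {pred nat}) (c : nat) : Prop :=
  (forall x, c <= x -> x \in S) /\
  (forall d, (forall x, d <= x -> x \in S) -> c <= d).

(* [pred x | s + x \in S] is the set S(s) - s = {y - s | y in S, y >= s}. *)
Definition arf_semigroup (S : {pred nat}) : Prop :=
  numerical_semigroup S /\
  forall s, s \in S -> add_closed [pred x | s + x \in S].

(** * Multiplicity sequences *)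

(* Sequences are indexed from 1: the value [m 0] is irrelevant. *)
Definition multiplicity_sequence (m : nat -> nat) : Prop :=
  [/\ forall n, 0 < n -> 0 < m n,
      forall n, 0 < n -> m n.+1 <= m n,
      exists2 k, 0 < k & forall n, k <= n -> m n = 1 &
      forall n, 0 < n ->
        exists2 s, n.+1 <= s & m n = \sum_(n.+1 <= k < s.+1) m k].

(* [written_as m v]: the finite vector v is the notation for the sequence m.
   It is [:: 1] if m is constantly 1, and otherwise [:: m 1; ...; m k] where
   m k is the last entry different from 1. *)
Definition written_as (m : nat -> nat) (v : seq nat) : Prop :=
  ((forall n, 0 < n -> m n = 1) /\ v = [:: 1]) \/
  (exists k, [/\ 0 < k, m k <> 1, forall n, k < n -> m n = 1 &
                 v = [seq m j | j <- iota 1 k]]).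

(* The partial sums 0, m_1, ..., m_1 + ... + m_k, and everything beyond the
   last one. For v = [:: 1] this is all of nat. *)
Definition AS (v : seq nat) : {pred nat} :=
  [pred x | (x \in 0 :: scanl addn 0 v) || (sumn v < x)].

(* Multiplicity sequences are identified with the vectors denoting them. *)
Definition Cond (n : nat) (v : seq nat) : Prop :=
  exists m, [/\ multiplicity_sequence m, written_as m v & is_conductor (AS v) n].

Definition multiplicity_sequence_of (S : {pred nat}) (v : seq nat) : Prop :=
  exists m, [/\ multiplicity_sequence m, written_as m v & S =i AS v].

(** * The algorithm *)

(* The current values of the set C and of the family of sets T. *)
Definition state : Type := ({fset seq nat} * (nat -> {fset seq nat}))%type.

Definition init_state (n : nat) : state :=
  ([fset [:: n]],
   fun i => if (2 <= i <= n - 2) && (i <= n./2) then [fset [:: i]] else fset0).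

Definition step_a (n i : nat) (M : seq nat) (C : {fset seq nat}) :
    {fset seq nat} :=
  if n - i \in AS M then C `|` [fset (n - i) :: M] else C.

Definition add_to (T : nat -> {fset seq nat}) (j : nat) (v : seq nat) :
    nat -> {fset seq nat} :=
  fun l => if l == j then T l `|` [fset v] else T l.

Definition step_b (n i : nat) (M : seq nat) (T : nat -> {fset seq nat}) :
    nat -> {fset seq nat} :=
  foldl (fun T' k => add_to T' (i + k) (k :: M)) T
        [seq k <- index_iota 2 ((n - i)./2).+1 | k \in AS M].

(* Since k >= 2, the pass over the elements of T(i) never modifies T(i). *)
Definition process (n : nat) (st : state) (i : nat) : state :=
  foldl (fun st' M => (step_a n i M st'.1, step_b n i M st'.2))
        st (enum_fset (st.2 i)).

(* [index_iota 2 n.-1] enumerates 2, 3, ..., n - 2. *)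
Definition algorithm (n : nat) : {fset seq nat} :=
  (foldl (process n) (init_state n) (index_iota 2 n.-1)).1.

(* Main.v *)
(** A vector different from [1] denotes a multiplicity sequence iff its entries
    are at least 2 and each entry a lies in AS(w), where w is the part of the
    vector following a; its conductor is then its sum. The algorithm builds
    these vectors from the last entry: it keeps those w satisfying
    sum(w) + head(w) <= n, and no others are needed, because a nonzero a in
    AS(w) is at least head(w). *)
Require Import Defs.
From mathcomp Require Import all_boot finmap.
From mathcomp Require Import zify.

Set Implicit Arguments.
Unset Strict Implicit.
Unset Printing Implicit Defensive.

(** * Recursive description of [AS] *)

Lemma AS_nil x : x \in AS [::].
Proof. by rewrite inE /= inE; case: x. Qed.

Lemma scanl_addnE a w : scanl addn a w = [seq a + y | y <- scanl addn 0 w].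
Proof.
elim: w a => [//|b w IH] a /=.
rewrite add0n IH (IH b) -map_comp; congr (_ :: _).
by apply: eq_map => y /=; rewrite addnA.
Qed.

(** Apart from 0, the partial sums of [a :: w] are those of [w], 0 included, translated by [a]. This
    recursion drives the later inductions on vectors. *)
Lemma AS_cons a w x :
  (x \in AS (a :: w)) = (x == 0) || (a <= x) && (x - a \in AS w).
Proof.
have ASE v y : (y \in AS v) = (y \in 0 :: scanl addn 0 v) || (sumn v < y) by [].
rewrite !ASE [scanl _ _ (_ :: _)]/= add0n scanl_addnE in_cons.
have -> : a :: [seq a + y | y <- scanl addn 0 w]
        = [seq a + y | y <- 0 :: scanl addn 0 w] by rewrite /= addn0.
case: (eqVneq x 0) => [//|_]; rewrite !orFb.
case: (leqP a x) => ax; rewrite ?andTb.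
  rewrite -{1}(subnKC ax) mem_map; last exact: addnI.
  by congr (_ || _) => /=; lia.
rewrite andFb ltnNge (_ : x <= sumn (a :: w)) ?orbF; last by move=> /=; lia.
by apply/negbTE/negP => /mapP[y _ xE]; lia.
Qed.

Lemma AS0 v : 0 \in AS v.
Proof. by rewrite inE inE. Qed.

Lemma AS_ge_sumn v x : sumn v <= x -> x \in AS v.
Proof.
elim: v x => [|a v IH] x /= h; first exact: AS_nil.
by rewrite AS_cons IH; lia.
Qed.

Lemma AS_ge_head v x : x \in AS v -> 0 < x -> head 0 v <= x.
Proof. by case: v => [//|a v]; rewrite AS_cons /=; case: eqP; lia. Qed.

(** * Arf property and conductor of [AS v] *)

Fixpoint arf_vector (v : seq nat) : bool :=
  if v is a :: w then [&& 1 < a, a \in AS w & arf_vector w] else true.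

Lemma AS_add_closed v : arf_vector v -> add_closed (AS v).
Proof.
elim: v => [_ x y _ _|a w IH /= /and3P[_ aw /IH addw] x y]; first exact: AS_nil.
rewrite !AS_cons; case/orP => [/eqP -> //|/andP[ax xw]].
case/orP => [/eqP ->|/andP[ay yw]]; first by rewrite addn0 ax xw orbT.
apply/orP; right; apply/andP; split; first lia.
(* Here [a] itself lies in [AS w], so closure of [AS w] is applied twice. *)
have -> : x + y - a = (x - a) + (a + (y - a)) by lia.
exact/addw/addw.
Qed.

(** A nonzero [s] is at least the first entry [a], and translating [AS (a :: w)] back by [s] gives
    the same set as translating [AS w] back by [s - a]. The case [s = 0] is plain additive
    closure. *)
Lemma AS_shift_add_closed v s :
  arf_vector v -> s \in AS v -> add_closed [pred x | s + x \in AS v].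
Proof.
elim: v s => [|a w IH] s; first by move=> _ _ x y _ _; apply: AS_nil.
move=> vP; rewrite AS_cons => /orP[/eqP -> x y|/andP[as_ sw] x y].
  exact: (AS_add_closed vP).
have shift z : (z \in [pred t | s + t \in AS (a :: w)])
               = (z \in [pred t | s - a + t \in AS w]).
  rewrite -[LHS]/(s + z \in _) -[RHS]/(s - a + z \in _) AS_cons.
  rewrite -addnBAC // (leq_trans as_ (leq_addr _ _)) /=.
  by case: eqP => //= sz0; have -> : s - a + z = 0 by lia; rewrite AS0.
rewrite !shift.
by case/and3P: vP => _ _ wP; apply: (IH _ wP sw).
Qed.

Lemma arf_AS v : arf_vector v -> arf_semigroup (AS v).
Proof.
move=> vP; split; last by move=> s; apply: AS_shift_add_closed.
split; [exact: AS0 | exact: AS_add_closed | exists (iota 0 (sumn v)) => x].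
by apply: contraR; rewrite mem_iota /= add0n -leqNgt; apply: AS_ge_sumn.
Qed.

(** Removing leading entries one by one reduces to the last entry [a]; since [a >= 2], the number
    [a - 1] lies strictly between 0 and [a]. This gives minimality of the conductor. *)
Lemma predn_sumn_notin_AS v :
  arf_vector v -> v != [::] -> (sumn v).-1 \notin AS v.
Proof.
elim: v => [//|a w IH] /= /and3P[a1 aw wP] _; rewrite AS_cons.
rewrite (_ : _ == 0 = false) /=; last lia.
case: (eqVneq w [::]) => [->|w0] /=; first lia.
have : 0 < sumn w by case: (w) w0 wP => //= b w' _ /and3P[]; lia.
rewrite negb_and => sw; apply/orP; right.
have -> : (a + sumn w).-1 - a = (sumn w).-1 by lia.
exact: IH.
Qed.

Lemma is_conductor_AS v n : arf_vector v -> v != [::] ->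
  is_conductor (AS v) n <-> sumn v = n.
Proof.
move=> vP v0; split=> [[geS minS]|<-].
  apply/eqP; rewrite eqn_leq (minS (sumn v)) => [|x]; last exact: AS_ge_sumn.
  rewrite andbT leqNgt; apply/negP => ltn.
  by have /negP := predn_sumn_notin_AS vP v0; apply; apply: geS; lia.
split=> [x|d geS]; first exact: AS_ge_sumn.
rewrite leqNgt; apply/negP => ltd.
by have /negP := predn_sumn_notin_AS vP v0; apply; apply: geS; lia.
Qed.

(** * Multiplicity sequences and their vectors *)

Lemma mem_AS_sum (m : nat -> nat) l j x : (forall i, j + l < i -> m i = 1) ->
  x \in AS [seq m i | i <- iota j.+1 l] <->
  exists2 s, j <= s & x = \sum_(j.+1 <= i < s.+1) m i.
Proof.
elim: l j x => [|l IH] j x m1 /=.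
  split=> _; last exact: AS_nil.
  (* All entries after index [j] are 1, so [x] is the sum of the next [x] of them. *)
  exists (j + x); first exact: leq_addr.
  rewrite (eq_big_nat _ _ (F2 := fun=> 1)) ?sum_nat_const_nat; first lia.
  by move=> i ij; apply: m1; lia.
rewrite AS_cons; split.
  case/orP => [/eqP ->|/andP[mx]]; first by exists j => //; rewrite big_geq.
  rewrite IH => [|i ?]; last by apply: m1; lia.
  case=> s js xE; exists s; first exact: ltnW.
  by rewrite big_ltn -?xE ?subnKC.
case=> s; rewrite leq_eqVlt => /orP[/eqP <- ->|js]; first by rewrite big_geq.
rewrite big_ltn // => xE; apply/orP; right; rewrite xE leq_addr addKn /=.
by apply/IH => [i ?|]; [apply: m1; lia | exists s].
Qed.

Lemma multiplicity_arf_vector m k : multiplicity_sequence m -> m k <> 1 ->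
  (forall i, k < i -> m i = 1) ->
  forall l j, j + l = k -> arf_vector [seq m i | i <- iota j.+1 l].
Proof.
case=> pos noninc _ sumP mk m1.
(* The last entry is positive and not 1; monotonicity carries the bound back to the earlier
   entries. *)
have gt1 d : d < k -> 1 < m (k - d).
  elim: d => [|d IH] dk; first by rewrite subn0; have := pos k; lia.
  apply: leq_trans (IH (ltnW dk)) _.
  by have := noninc (k - d.+1); rewrite (subnSK (ltnW dk)); apply; lia.
elim=> [//|l IH] j jl /=.
rewrite (IH j.+1) ?andbT; last lia.
apply/andP; split; first by have := gt1 l; rewrite -jl -addSnnS addnK; apply; lia.
apply/mem_AS_sum => [i ?|]; first by apply: m1; lia.
by have [s js ->] := sumP j.+1 isT; exists s => //; apply: ltnW.
Qed.

Lemma arf_vector_drop j v : arf_vector v -> arf_vector (drop j v).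
Proof. by elim: v j => [|a w IH] [|j] //= /and3P[_ _ /IH]. Qed.

Lemma arf_vector_nth_gt1 v i : arf_vector v -> i < size v -> 1 < nth 1 v i.
Proof. by elim: v i => [|a w IH] [|i] //= /and3P[? _ /IH]; auto. Qed.

Lemma map_nth_iota_drop (v : seq nat) j :
  [seq nth 1 v i.-1 | i <- iota j.+1 (size v - j)] = drop j v.
Proof.
apply: (@eq_from_nth _ 1) => [|i]; first by rewrite size_map size_iota size_drop.
rewrite size_map size_iota => ij.
by rewrite (nth_map 0) ?size_iota // nth_iota // nth_drop.
Qed.

(** The default value 1 of [nth] supplies the constant tail, and [i.-1] converts indices starting at
    1 into list positions. *)
Lemma arf_vector_multiplicity v :
  arf_vector v -> multiplicity_sequence (fun i => nth 1 v i.-1).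
Proof.
move=> vP; have out i : size v < i -> nth 1 v i.-1 = 1.
  by move=> vi; rewrite nth_default; lia.
have pos i : 0 < nth 1 v i.
  case: (ltnP i (size v)) => vi; last by rewrite nth_default.
  exact/ltnW/arf_vector_nth_gt1.
have sumP j : 0 < j -> exists2 s, j < s &
    nth 1 v j.-1 = \sum_(j.+1 <= k < s.+1) nth 1 v k.-1.
  case: j => // j _ /=.
  have /mem_AS_sum : nth 1 v j \in
      AS [seq nth 1 v i.-1 | i <- iota j.+2 (size v - j.+1)].
    rewrite map_nth_iota_drop.
    case: (ltnP j (size v)) => vj; last by rewrite drop_oversize ?AS_nil //; lia.
    by have := arf_vector_drop j vP; rewrite (drop_nth 1) //= => /and3P[].
  case=> [i ?|s]; first by apply: out; lia.
  (* An empty sum would make a positive entry zero, so the sum has at least one term. *)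
  rewrite leq_eqVlt => /orP[/eqP <-|js]; last by exists s.
  by rewrite big_geq // => z; have := pos j; rewrite z.
split=> //; last by exists (size v).+1 => // i; apply: out.
(* Monotonicity follows from the sum condition: the next entry is the first term of the sum. *)
move=> j /sumP[s js ->].
by rewrite big_ltn ?leq_addr //; lia.
Qed.

Lemma arf_vector_written_as v : arf_vector v -> v != [::] ->
  written_as (fun i => nth 1 v i.-1) v.
Proof.
rewrite -size_eq0 -lt0n => vP v0; right; exists (size v); split=> //.
- move=> /= e; have : 1 < nth 1 v (size v).-1; last by rewrite e.
  by apply: arf_vector_nth_gt1; rewrite // ltn_predL.
- by move=> i vi; rewrite nth_default; lia.
- by have := map_nth_iota_drop v 0; rewrite subn0 drop0.
Qed.

Lemma CondP n v : 1 < n ->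
  Cond n v <-> [/\ arf_vector v, v != [::] & sumn v = n].
Proof.
move=> n1; split=> [[m [mP]]|[vP v0 sv]]; last first.
  exists (fun i => nth 1 v i.-1); split.
  - exact: arf_vector_multiplicity.
  - exact: arf_vector_written_as.
  - exact/is_conductor_AS.
case=> [[_ ->] [_ minS]|[k [k0 mk m1 vE]] cond].
  (* For the constant sequence, [AS [:: 1]] contains every natural number, so the conductor is 0,
     against [1 < n]. *)
  have : n <= 0; last lia.
  by apply: minS => -[|x] _; rewrite ?AS0 ?AS_ge_sumn.
have vP : arf_vector v by rewrite vE; apply: (multiplicity_arf_vector mP mk m1).
have v0 : v != [::] by rewrite vE; case: (k) k0.
by split=> //; apply/is_conductor_AS.
Qed.

(** * Effect of one pass of the algorithm *)

Lemma mem_add_to T j v l u :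
  (u \in add_to T j v l) = (u \in T l) || (l == j) && (u == v).
Proof. by rewrite /add_to; case: eqP; rewrite ?inE ?orbF. Qed.

Lemma mem_foldl_add_to (f : nat -> nat) (g : nat -> seq nat) ks T l u :
  (u \in foldl (fun T' k => add_to T' (f k) (g k)) T ks l) =
  (u \in T l) || has (fun k => (l == f k) && (u == g k)) ks.
Proof.
by elim: ks T => [|k ks IH] T /=; rewrite ?orbF // IH mem_add_to orbA.
Qed.

(** The bound on [k] is freed from halving: for [i = sumn M] it becomes the size condition of
    [extendable] for [k :: M]. *)
Lemma mem_step_b n i M T l u :
  (u \in step_b n i M T l) <->
  u \in T l \/ exists k, [/\ 1 < k, k.*2 + i <= n, k \in AS M, l = i + k &
                             u = k :: M].
Proof.
rewrite /step_b mem_foldl_add_to; split.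
  case/orP => [|/hasP[k]]; first by left.
  rewrite mem_filter mem_index_iota => /and3P[kM k1 kn] /andP[/eqP-> /eqP->].
  by right; exists k; split=> //; lia.
case=> [->//|[k [k1 kn kM -> ->]]]; apply/orP; right; apply/hasP; exists k.
  by rewrite mem_filter mem_index_iota kM k1 /=; lia.
by rewrite !eqxx.
Qed.

Lemma mem_step_a n i M C u :
  (u \in step_a n i M C) <-> u \in C \/ n - i \in AS M /\ u = (n - i) :: M.
Proof.
rewrite /step_a; case: ifP => nM; last by split=> [|[|[]]//]; first by left.
rewrite !inE; split=> [/orP[|/eqP]|[->//|[_ ->]]];
  by [left | right | rewrite eqxx orbT].
Qed.

Lemma mem_foldl_step1 n i Ms st u :
  u \in (foldl (fun st' M => (step_a n i M st'.1, step_b n i M st'.2))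
               st Ms).1 <->
  u \in st.1 \/ exists M, [/\ M \in Ms, n - i \in AS M & u = (n - i) :: M].
Proof.
elim: Ms st => [|M Ms IH] st /=.
  by split=> [|[//|[? []]//]]; left.
rewrite IH /= mem_step_a; split.
  case=> [[|[nM ->]]|[N [NMs nN ->]]]; first by left.
    by right; exists M; rewrite mem_head.
  by right; exists N; rewrite inE NMs orbT.
case=> [|[N []]]; first by left; left.
rewrite inE => /orP[/eqP ->|NMs] nN ->; first by left; right.
by right; exists N.
Qed.

Lemma mem_process1 n st i u :
  u \in (process n st i).1 <->
  u \in st.1 \/ exists M, [/\ M \in st.2 i, n - i \in AS M & u = (n - i) :: M].
Proof. exact: mem_foldl_step1. Qed.

Lemma mem_foldl_step2 n i Ms st l u :
  u \in (foldl (fun st' M => (step_a n i M st'.1, step_b n i M st'.2))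
               st Ms).2 l <->
  u \in st.2 l \/ exists M k, [/\ M \in Ms, 1 < k, k.*2 + i <= n, k \in AS M
                                & l = i + k /\ u = k :: M].
Proof.
elim: Ms st => [|M Ms IH] st /=.
  by split=> [|[//|[? [? []]]//]]; left.
rewrite IH /= mem_step_b; split.
  case=> [[|[k [k1 kn kM -> ->]]]|[N [k [NMs k1 kn kN [-> ->]]]]]; first by left.
    by right; exists M, k; rewrite mem_head.
  by right; exists N, k; rewrite inE NMs orbT.
case=> [|[N [k []]]]; first by left; left.
rewrite inE => /orP[/eqP ->|NMs] k1 kn kN [-> ->]; last by right; exists N, k.
by left; right; exists k.
Qed.

Lemma mem_process2 n st i l u :
  u \in (process n st i).2 l <->
  u \in st.2 l \/ exists M k, [/\ M \in st.2 i, 1 < k, k.*2 + i <= n, k \in AS M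
                                & l = i + k /\ u = k :: M].
Proof. exact: mem_foldl_step2. Qed.

(** * Loop invariant and correctness of the algorithm *)

Definition extendable (n : nat) (v : seq nat) : bool :=
  [&& arf_vector v, v != [::] & sumn v + head 0 v <= n].

Lemma sumn_behead_lt v : arf_vector v -> v != [::] -> sumn (behead v) < sumn v.
Proof. by case: v => //= a w /and3P[? _ _] _; lia. Qed.

(* The state just before the pass of index j + 2. *)
Lemma algorithm_invariant n j : j + 2 < n.+1 ->
  let st := foldl (process n) (init_state n) (iota 2 j) in
  (forall v : seq nat, v \in st.1 <->
     v = [:: n] \/ exists M, [/\ extendable n M, sumn M < j + 2,
                   n - sumn M \in AS M & v = (n - sumn M) :: M]) /\
  (forall l (v : seq nat), v \in st.2 l <->
     [/\ extendable n v, sumn v = l & sumn (behead v) < j + 2]).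
Proof.
elim: j => [|j IH] jn.
  split=> [v|l v] /=.
    rewrite inE; split=> [/eqP|[->//|[M [/and3P[MP M0 _] sM _ _]]]].
      by left.
    by case: M MP M0 sM => //= a w /and3P[? _ _]; lia.
  (* A nonempty tail has sum at least 2, so before the first pass only singletons qualify. *)
  case: ifP => [/andP[/andP[l2 ln] ln2]|l2].
    rewrite inE; split=> [/eqP ->|[/and3P[vP v0 vn] sv]].
      by rewrite /extendable /= AS_nil; split; lia.
    case: v vP v0 vn sv => //= a [|b w] /and3P[a1 _ wP] _ _; rewrite /= ?addn0.
      by move=> ->.
    by case/and3P: wP; lia.
  rewrite inE; split=> // -[/and3P[vP v0 vn] sv].
  case: v vP v0 vn sv => //= a [|b w] /and3P[a1 _ wP] _ /=; rewrite ?addn0.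
    by move: l2; lia.
  by case/and3P: wP; lia.
rewrite -(addn1 j) iotaD foldl_cat /=.
have [|IH1 IH2] := IH; first lia.
set st := foldl _ _ _ in IH1 IH2 *.
split=> [v|l v].
  rewrite mem_process1 IH1; split.
    case=> [[->|[M [MP sM nM ->]]]|[M []]]; first by left.
      by right; exists M; split=> //; lia.
    rewrite IH2 => -[MP sM _] nM ->; right; exists M.
    by rewrite sM; split=> //; lia.
  case=> [->|[M [MP sM nM ->]]]; first by left; left.
  case: (ltnP (sumn M) (j + 2)) => sMj; first by left; right; exists M.
  (* The vectors [M] newly allowed are those of sum exactly [j + 2], all present in T at that
     index. *)
  have sME : sumn M = 2 + j by lia.
  right; exists M; rewrite -sME; split=> //; rewrite IH2; split=> //.
  by case/and3P: MP => MP M0 _; rewrite (addnC j) -sME sumn_behead_lt.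
rewrite mem_process2 IH2; split.
  case=> [[vP <- sv]|[M [k []]]]; first by split=> //; lia.
  rewrite IH2 => -[/and3P[MP _ _] sM _] k1 kn kM [-> ->].
  rewrite /extendable /= k1 kM MP /= sM.
  by split; lia.
case=> vP sv svb; case: (ltnP (sumn (behead v)) (j + 2)) => svj; first by left.
right; case/and3P: vP; case: v sv svb svj => // k M /= sv svb svj.
move=> /and3P[k1 kM MP] _ vn; exists M, k; split=> //; try by lia.
  (* The tail [M] is itself extendable: [head 0 M <= k] because [k] is a nonzero element of [AS M],
     and [sumn M + k.*2 <= n]. *)
  rewrite IH2; have M0 : M != [::] by case: (M) svj => //=; lia.
  rewrite /extendable MP M0 /=; have := sumn_behead_lt MP M0.
  by have := AS_ge_head kM (ltnW k1); split; lia.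
by split=> //; lia.
Qed.

Lemma mem_algorithm n v : 1 < n ->
  v \in algorithm n <-> [/\ arf_vector v, v != [::] & sumn v = n].
Proof.
move=> n1; rewrite /algorithm /index_iota.
(* For [n >= 3] the bound [j + 2] is [n - 1], which forces the new first entry to be at least 2. For
   [n = 2] the subtraction truncates and the bound is 2, which no nonempty Arf vector meets. *)
have [|-> _] := @algorithm_invariant n (n.-1 - 2); first lia.
split.
  case=> [->|[M [/and3P[MP M0 Mn] sM nM ->]]].
    by rewrite /= n1 AS_nil addn0.
  have : 1 < sumn M by case: (M) MP M0 => //= a w /and3P[]; lia.
  by rewrite /= nM MP; split=> //; lia.
case; case: v => //= a w /and3P[a1 aw wP] _ sE.
case: (eqVneq w [::]) => [w0|w0].
  by left; move: sE; rewrite w0 /= addn0 => ->.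
have aE : n - sumn w = a by lia.
have head_le := AS_ge_head aw (ltnW a1).
have w1 : 1 < sumn w by case: (w) wP w0 => //= b w' /and3P[]; lia.
by right; exists w; rewrite aE /extendable wP w0; split=> //; lia.
Qed.

Theorem mainTheorem1 (n : nat) (hn : 1 < n) :
  (forall v : seq nat, v \in algorithm n <-> Cond n v) /\
  (forall v : seq nat, Cond n v <->
     exists S : {pred nat},
       [/\ arf_semigroup S, is_conductor S n & multiplicity_sequence_of S v]).
Proof.
split=> v; first by rewrite mem_algorithm // CondP.
split=> [vC|[S [_ [geS minS] [m [mP mv SE]]]]].
  case: (vC) => m [mP mv cond]; exists (AS v); split=> //; last by exists m.
  by case/(CondP _ hn): vC => vP _ _; apply: arf_AS.
exists m; split=> //; split=> [x xn|d dS]; first by rewrite -SE geS.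
by apply: minS => x xd; rewrite SE dS.
Qed.
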